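(* Let a document of tokens $v_1,\dots,v_N$ be generated by a token-exchangeable topic model on $\widetilde{\mathcal V}$, i.e. given $\boldsymbol\theta$ the tokens $v_1,v_2,\dots$ are i.i.d. draws from $\pi_{\boldsymbol\theta}$, and suppose $0<e(\boldsymbol\theta)<1$. Let $\mathrm{FKGL}_N$ be the readability score computed on the first $N$ tokens. Then, conditionally on $\boldsymbol\theta$, almost surely as $N\to\infty$, $$\mathrm{FKGL}_N\longrightarrow \Phi(\boldsymbol\theta),\qquad \Phi(\boldsymbol\theta)= a\,\frac{1-e(\boldsymbol\theta)}{e(\boldsymbol\theta)}+b\,\frac{\sigma(\boldsymbol\theta)}{1-e(\boldsymbol\theta)}+c .$$
   Context: $\mathcal V$ is a finite word vocabulary, $\dashv$ is a sentence-boundary token, and $\widetilde{\mathcal V}=\mathcal V\cup\{\dashv\}$. $\mathrm{syl}:\mathcal V\to[1,s_{\max}]$ is a fixed bounded (real-valued) syllable count, extended by $\mathrm{syl}(\dashv)=0$. $\Delta^{m-1}$ is the probability simplex in $\mathbb R^m$. A token-exchangeable topic model consists of a document-level variable $\boldsymbol\theta\in\Delta^{K-1}$ with some prior and a map $\boldsymbol\theta\mapsto\pi_{\boldsymbol\theta}\in\Delta^{|\widetilde{\mathcal V}|-1}$ such that, given $\boldsymbol\theta$, the tokens of a document are i.i.d. from $\pi_{\boldsymbol\theta}$. All probabilistic statements are conditional on $\boldsymbol\theta$. Define $e(\boldsymbol\theta)=\pi_{\boldsymbol\theta}(\dashv)$ and $\sigma(\boldsymbol\theta)=\sum_{w\in\mathcal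 V}\pi_{\boldsymbol\theta}(w)\,\mathrm{syl}(w)$. For a token sequence let $S_N=\sum_{n\le N}\mathbf 1[v_n=\dashv]$ (sentences), $W_N=N-S_N$ (words), $Y_N=\sum_{n\le N}\mathrm{syl}(v_n)$ (syllables), and $\mathrm{FKGL}_N=a\,W_N/S_N+b\,Y_N/W_N+c$, with an arbitrary fixed value assigned when $S_N=0$ or $W_N=0$. The coefficients $(a,b,c)$ are fixed real constants: $(0.39,11.8,-15.59)$ (Flesch–Kincaid Grade Level) or $(-1.015,-84.6,206.835)$ (Flesch Reading Ease). *)

(* Defs.v *)
From mathcomp Require Import all_boot all_order all_algebra.
From mathcomp Require Import all_classical all_reals all_analysis.

Set Implicit Arguments.
Unset Strict Implicit.
Unset Printing Implicit Defensive.

Import Order.TTheory GRing.Theory Num.Theory.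
Import numFieldNormedType.Exports.

Local Open Scope classical_set_scope.
Local Open Scope ring_scope.

(* Given a vocabulary V, the type of tokens is [option V]: [Some w] is the
   word w and [None] is the sentence-boundary token. *)

Definition in_simplex (R : realType) (I : finType) (p : I -> R) : Prop :=
  (forall i, 0 <= p i) /\ \sum_i p i = 1.

Section iid.
Context (R : realType) (d : measure_display) (Omega : measurableType d).
Context (T : finType).

(* T carries the discrete sigma-algebra. *)
Definition discrete_rv (X : Omega -> T) : Prop :=
  forall t, measurable (X @^-1` [set t]).

Definition mutually_independent (P : {measure set Omega -> \bar R})
    (X : nat -> Omega -> T) : Prop :=
  forall (J : seq nat) (A : nat -> set T), uniq J ->
    fine (P (\bigcap_(n in [set` J]) (X n @^-1` A n))) =
    \prod_(n <- J) fine (P (X n @^-1` A n)).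

Definition iid_draws (P : {measure set Omega -> \bar R})
    (X : nat -> Omega -> T) (p : T -> R) : Prop :=
  (forall n t, P (X n @^-1` [set t]) = (p t)%:E) /\ mutually_independent P X.

End iid.

(* The infinite token sequence of a document is [tokens 0, tokens 1, ...].
   [cond] is a regular conditional probability given the document-level
   variable: [cond t] is the law "conditionally on theta = t".  The simplex of
   R^K is a subset of the measurable type of K-tuples, so [word_law t] and
   [cond t] are only meaningful for t in the simplex. *)
Record topic_model (R : realType) (V : finType) (K : nat)
    (d : measure_display) (Omega : measurableType d) := TopicModel {
  law : probability Omega R ;
  theta : Omega -> K.-tuple (measurableTypeR R) ;
  prior : probability (K.-tuple (measurableTypeR R)) R ;
  word_law : K.-tuple (measurableTypeR R) -> option V -> R ;
  tokens : nat -> Omega -> option V ;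
  cond : R.-pker K.-tuple (measurableTypeR R) ~> Omega ;
  theta_measurable : measurable_fun setT theta ;
  theta_simplex : forall x, in_simplex (tnth (theta x)) ;
  theta_prior : forall B, measurable B -> law (theta @^-1` B) = prior B ;
  word_law_simplex : forall t, in_simplex (tnth t) -> in_simplex (word_law t) ;
  tokens_measurable : forall n, discrete_rv (tokens n) ;
  cond_disintegration : forall A B, measurable A -> measurable B ->
    law (A `&` theta @^-1` B) = (\int[prior]_(t in B) cond t A)%E ;
  tokens_iid : forall t, in_simplex (tnth t) ->
    iid_draws (cond t) tokens (word_law t)
}.

Section readability.
Context (R : realType) (V : finType).
Variable syl : V -> R.

Definition syl_tok (t : option V) : R := if t is Some w then syl w else 0.

Definition sentences (v : nat -> option V) (N : nat) : nat :=
  (\sum_(n < N) (v n == None))%N.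

Definition words (v : nat -> option V) (N : nat) : nat :=
  (N - sentences v N)%N.

Definition syllables (v : nat -> option V) (N : nat) : R :=
  \sum_(n < N) syl_tok (v n).

(* dflt is the arbitrary value given to documents without words or without
   sentences. *)
Definition fkgl (a b c dflt : R) (v : nat -> option V) (N : nat) : R :=
  if (sentences v N == 0%N) || (words v N == 0%N) then dflt
  else a * ((words v N)%:R / (sentences v N)%:R)
       + b * (syllables v N / (words v N)%:R) + c.

Definition boundary_prob (p : option V -> R) : R := p None.

Definition mean_syl (p : option V -> R) : R := \sum_(w : V) p (Some w) * syl w.

Definition fkgl_limit (a b c : R) (p : option V -> R) : R :=
  a * ((1 - boundary_prob p) / boundary_prob p)
  + b * (mean_syl p / (1 - boundary_prob p)) + c.

End readability.

(* Flesch-Kincaid Grade Level, resp. Flesch Reading Ease. *)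
Definition readability_coefs (R : realType) (a b c : R) : Prop :=
  (a, b, c) = (39 / 100, 118 / 10, - (1559 / 100)) \/
  (a, b, c) = (- (1015 / 1000), - (846 / 10), 206 + 835 / 1000).

(* Main.v *)
(* With a finite token alphabet, the strong law of large numbers follows from
   Chernoff bounds and the Borel-Cantelli lemma.  If f has negative mean under
   p, then for a small l > 0 the exponential moment r of l * f is < 1, hence
   P(sum_(i < n) f(X_i) >= 0) <= r ^ n, which is summable.  Applied to the
   deviations of the boundary indicator and of the syllable count, this gives
   S_N / N -> e and Y_N / N -> sigma almost surely; the score is a continuous
   function of these two ratios. *)

Require Import Defs.
From mathcomp Require Import all_boot all_order all_algebra.
From mathcomp Require Import all_classical all_reals all_analysis.
From mathcomp Require Import ring lra.
Import Order.TTheory GRing.Theory Num.Theory.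
Import numFieldNormedType.Exports.
Local Open Scope classical_set_scope.
Local Open Scope ring_scope.

(** Since [expR x * (1 - x) <= expR x * expR (- x) = 1], it suffices that [(1 + x + 2 * x ^+ 2) * (1
    - x) = 1 + x ^+ 2 * (1 - 2 * x)] is at least 1. *)
Lemma expR_le1DxD2sqr {R : realType} (x : R) :
  `|x| <= 1 / 2 -> expR x <= 1 + x + 2 * x ^+ 2.
Proof.
rewrite ler_norml => /andP[x_ge x_le].
have : expR x * (1 - x) <= expR x * expR (- x).
  by rewrite ler_pM2l ?expR_gt0// expR_ge1Dx.
rewrite -expRD subrr expR0 => le1.
have x1 : 0 < 1 - x by lra.
rewrite -(ler_pM2r x1) (le_trans le1)//.
have -> : (1 + x + 2 * x ^+ 2) * (1 - x) = 1 + x ^+ 2 * (1 - 2 * x) by ring.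
by rewrite lerDl mulr_ge0 ?sqr_ge0//; lra.
Qed.

(** With mean [m] and [C] bounding [|f|], the second-order bound gives a moment of at most
    [1 + l * m + 2 * (l * C) ^+ 2], whose linear term is negative. *)
Lemma exp_moment_lt1 {R : realType} {T : finType} (p f : T -> R) :
  in_simplex p -> \sum_t p t * f t < 0 ->
  exists2 l : R, 0 < l & \sum_t p t * expR (l * f t) < 1.
Proof.
move=> [p_ge0 p1] f_lt0; set m := \sum_t _ in f_lt0.
(* [C] dominates every [|f t|], and also [- m], which will keep [l * C] below 1/2. *)
pose C := 1 - m + \sum_t `|f t|.
have sum_ge0 : 0 <= \sum_t `|f t| by exact: sumr_ge0.
have C_ge1 : 1 <= C by rewrite /C; lra.
have fC t : `|f t| <= C.
  have : `|f t| <= \sum_t `|f t|.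
    by rewrite (bigD1 t)//= lerDl sumr_ge0.
  by rewrite /C; lra.
have C_gt0 : 0 < C by lra.
have mC : - m <= C by rewrite /C; lra.
(* The minimiser of the quadratic bound, where its value is [1 + l * m / 2]. *)
pose l := - m / (4 * C ^+ 2).
have C2 : 0 < 4 * C ^+ 2 by rewrite mulr_gt0// exprn_gt0.
have l_gt0 : 0 < l by rewrite divr_gt0// oppr_gt0.
have lC2 : l * C ^+ 2 = - m / 4 by rewrite /l; field; rewrite lt0r_neq0.
have lC : l * C <= 1 / 2.
  by rewrite -(ler_pM2r C_gt0) -mulrA -expr2 lC2; lra.
exists l => //.
have bound t : p t * expR (l * f t) <=
    p t + l * (p t * f t) + p t * (2 * (l * C) ^+ 2).
  have lfC : `|l * f t| <= l * C by rewrite normrM gtr0_norm// ler_pM2l.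
  have le2 : (l * f t) ^+ 2 <= (l * C) ^+ 2.
    by rewrite -(real_normK (num_real (l * f t))) ler_pXn2r// nnegrE ltW// mulr_gt0.
  have h : expR (l * f t) <= 1 + l * f t + 2 * (l * C) ^+ 2.
    by have := expR_le1DxD2sqr _ (le_trans lfC lC); lra.
  by have := ler_wpM2l (p_ge0 t) h; lra.
apply: (le_lt_trans (ler_sum _ (fun t _ => bound t))).
rewrite !big_split/= -mulr_sumr -/m -mulr_suml p1 mul1r.
have -> : 2 * (l * C) ^+ 2 = 2 * l * (l * C ^+ 2) by ring.
by rewrite lC2; have : l * m < 0 by [rewrite pmulr_rlt0]; lra.
Qed.

Section iid_frequencies.
Context {R : realType} {d : measure_display} {Omega : measurableType d}.
Context {T : finType} (P : {measure set Omega -> \bar R}).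
Context (X : nat -> Omega -> T) (p : T -> R).
Context (X_rv : forall n, discrete_rv (X n)) (X_iid : iid_draws P X p).
Context (PT : P setT = 1%E).

(** The event that the first [n] draws spell [a], indexed by naturals to match
    [mutually_independent]; the [setT] branch is never reached on [iota 0 n]. *)
Let cylinder n (a : {ffun 'I_n -> T}) : set Omega :=
  \bigcap_(i in [set` iota 0 n])
    X i @^-1` (if insub i is Some j then [set a j] else setT).

Let cylinderP n (a : {ffun 'I_n -> T}) x :
  cylinder n a x <-> a = [ffun i => X (val i) x].
Proof.
split.
  move=> ax; apply/ffunP => i; rewrite ffunE.
  have := ax (val i); rewrite /= mem_iota/= add0n ltn_ord => /(_ isT).
  by rewrite valK.
move=> -> i /=; rewrite mem_iota add0n => /= ltin.
by rewrite insubT/= ffunE.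
Qed.

Let cylinder_measurable n (a : {ffun 'I_n -> T}) : measurable (cylinder n a).
Proof.
apply: fin_bigcap_measurable => [|i _]; first exact: finite_seq.
by case: insubP => [j _ _|_]; [exact: X_rv|rewrite preimage_setT].
Qed.

Let cylinder_prob n (a : {ffun 'I_n -> T}) :
  P (cylinder n a) = (\prod_i p (a i))%:E.
Proof.
have [Xp Xind] := X_iid.
(* Independence is stated through [fine], so finiteness is needed to return to extended reals. *)
have fin : P (cylinder n a) \is a fin_num.
  rewrite ge0_fin_numE// (le_lt_trans (y := 1%E)) ?ltry// -PT.
  by rewrite le_measure// inE//; exact: cylinder_measurable.
rewrite -(fineK fin) Xind ?iota_uniq//; congr (_%:E).
rewrite -[in iota 0 n](subn0 n) -/(index_iota 0 n) big_mkord.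
by apply: eq_bigr => i _; rewrite valK Xp.
Qed.

Let event_cylinders n (B : pred {ffun 'I_n -> T}) :
  [set x | B [ffun i => X (val i) x]] = \big[setU/set0]_(a | B a) cylinder n a.
Proof.
apply/seteqP; split => x.
  move=> /= Bx; rewrite (bigD1 [ffun i => X (val i) x])//=.
  by left; apply/cylinderP.
elim/big_ind: _ => [//|U W UB WB [/UB|/WB]//|a Ba /cylinderP ax].
by rewrite /= -ax.
Qed.

Lemma event_measurable n (B : pred {ffun 'I_n -> T}) :
  measurable [set x | B [ffun i => X (val i) x]].
Proof.
by rewrite event_cylinders; apply: bigsetU_measurable => a _.
Qed.

Lemma event_prob_le n (B : pred {ffun 'I_n -> T}) :
  (P [set x | B [ffun i => X (val i) x]] <=
   (\sum_(a | B a) \prod_i p (a i))%:E)%E.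
Proof.
rewrite event_cylinders -sumEFin.
(* Measurability is carried through the induction because each use of subadditivity requires it. *)
suff [] : measurable (\big[setU/set0]_(a | B a) cylinder n a) /\
  (P (\big[setU/set0]_(a | B a) cylinder n a) <=
   \sum_(a | B a) (\prod_i p (a i))%:E)%E by [].
elim/big_rec2 : _ => [|a s U Ba [mU Us]]; first by rewrite measure0.
split; first exact: measurableU.
apply: (le_trans (measureU2 _ (cylinder_measurable n a) mU)).
by apply: leeD => //; rewrite -cylinder_prob.
Qed.

(** Markov's inequality: the power expands into a sum over all words [a] of length [n], and a word
    with [\prod_i h (a i) >= 1] contributes at least its probability. *)
Lemma prod_ge1_prob_le (h : T -> R) n : (forall t, 0 <= p t) ->
  (forall t, 0 <= h t) ->
  (P [set x | (1 <= \prod_(i < n) h (X i x))%R] <=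
   ((\sum_t p t * h t) ^+ n)%R%:E)%E.
Proof.
move=> p_ge0 h_ge0.
have -> : [set x | 1 <= \prod_(i < n) h (X i x)] =
    [set x | [pred a : {ffun 'I_n -> T} | 1 <= \prod_i h (a i)]
               [ffun i => X (val i) x]].
  by apply: eq_set => x /=; under [in RHS]eq_bigr do rewrite ffunE.
apply: (le_trans (event_prob_le _ _)); rewrite lee_fin.
rewrite -[n in _ ^+ n]card_ord -prodr_const bigA_distr_bigA /=.
rewrite [leRHS](bigID (fun a : {ffun 'I_n -> T} => 1 <= \prod_i h (a i)))/=.
rewrite -[leLHS]addr0 lerD//; last first.
  by apply: sumr_ge0 => a _; apply: prodr_ge0 => i _; exact: mulr_ge0.
apply: ler_sum => a ha; rewrite big_split/= ler_peMr//.
exact: prodr_ge0.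
Qed.

Lemma ae_eventually_sum_lt0 (f : T -> R) : in_simplex p ->
  \sum_t p t * f t < 0 ->
  {ae P, forall x, \forall n \near \oo, \sum_(i < n) f (X i x) < 0}.
Proof.
move=> p_simplex /(exp_moment_lt1 _ _ p_simplex)[l l_gt0]; set r := \sum_t _.
move=> r_lt1; have p_ge0 := p_simplex.1.
have r_ge0 : 0 <= r by apply: sumr_ge0 => t _; rewrite mulr_ge0 ?expR_ge0.
(* As [l > 0], this is the event that the sum is nonnegative, in the multiplicative form of the
   Markov bound. *)
pose F n := [set x | 1 <= \prod_(i < n) expR (l * f (X i x))].
have mF n : measurable (F n).
  have -> : F n =
      [set x | [pred a : {ffun 'I_n -> T} | 1 <= \prod_i expR (l * f (a i))]
                 [ffun i => X (val i) x]].
    by apply: eq_set => x /=; under [in RHS]eq_bigr do rewrite ffunE.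
  exact: event_measurable.
have F_le n : (P (F n) <= (r ^+ n)%:E)%E.
  by apply: prod_ge1_prob_le => // t; exact: expR_ge0.
have F_summable : (\sum_(0 <= n <oo) P (F n) < +oo)%E.
  apply: (@le_lt_trans _ _ (1 / (1 - r))%:E); last exact: ltry.
  apply: lime_le; first exact: is_cvg_nneseries.
  apply: nearW => n.
  apply: (@le_trans _ _ (\sum_(0 <= i < n) (r ^+ i)%:E)%E).
    exact: lee_sum.
  rewrite sumEFin lee_fin.
  have -> : \sum_(0 <= i < n) r ^+ i = (1 - r ^+ n) / (1 - r).
    have r1 : 1 - r != 0 by rewrite subr_eq0 gt_eqF.
    apply: (mulIf r1); rewrite mulfVK// big_mkord.
    by have := subrX1 r n; lra.
  by rewrite ler_pM2r ?invr_gt0 ?subr_gt0// gerBl exprn_ge0.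
(* Borel-Cantelli: the limsup is null, and outside it only finitely many [F n] occur. *)
exists (lim_sup_set F); split.
- by apply: bigcapT_measurable => n; exact: bigcup_measurable.
- exact: lim_sup_set_cvg0.
- move=> x; apply: contra_notP => /existsNP[n] xn; exists n => // k /= nk.
  rewrite ltNge; apply/negP => fk; apply: xn => _; exists k => //=.
  rewrite /F/= -expR_sum -mulr_sumr -expR0 ler_expR.
  by rewrite mulr_ge0// ltW.
Qed.

Lemma strong_law (g : T -> R) : in_simplex p ->
  {ae P, forall x, (\sum_(i < n) g (X i x)) / n%:R @[n --> \oo] -->
     \sum_t p t * g t}.
Proof.
move=> p_simplex; set m := \sum_t _.
have shift (s e : R) : \sum_t p t * (s * (g t - m) - e) = - e.
  under eq_bigr do rewrite mulrBr mulrCA mulrBr.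
  rewrite sumrB -mulr_sumr sumrB -!mulr_suml p_simplex.2 /m; ring.
(* The sign [s] selects upper or lower deviations. Tolerances [1/(k+1)] form a countable family, so
   one null set serves them all. *)
have dev (s : R) : {ae P, forall x, forall k, \forall n \near \oo,
    \sum_(i < n) (s * (g (X i x) - m) - k.+1%:R^-1) < 0}.
  apply/ae_foralln => k.
  apply: (ae_eventually_sum_lt0 (fun t => s * (g t - m) - k.+1%:R^-1)) => //.
  by rewrite shift oppr_lt0 invr_gt0.
apply: filterS2 (dev 1) (dev (-1)) => x up lo.
apply/cvgrPdist_lt => e e_gt0.
have [k ke] : exists k, k.+1%:R^-1 < e :> R.
  exists (Num.bound e^-1); rewrite invf_plt ?posrE//.
  have /archi_boundP/lt_le_trans : 0 <= e^-1 by rewrite invr_ge0 ltW.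
  by apply; rewrite ler_nat.
near=> n.
have n_gt0 : 0 < n%:R :> R by rewrite ltr0n; near: n; exact: nbhs_infty_gt.
have sumE (s : R) : \sum_(i < n) (s * (g (X i x) - m) - k.+1%:R^-1) =
    n%:R * (s * ((\sum_(i < n) g (X i x)) / n%:R - m) - k.+1%:R^-1).
  rewrite sumrB -mulr_sumr sumrB !sumr_const card_ord.
  rewrite -[m *+ n]mulr_natl -[_^-1 *+ n]mulr_natl.
  by field; rewrite nat1r !gt_eqF.
have : \sum_(i < n) (1 * (g (X i x) - m) - k.+1%:R^-1) < 0.
  by near: n; exact: up.
have : \sum_(i < n) (-1 * (g (X i x) - m) - k.+1%:R^-1) < 0.
  by near: n; exact: lo.
rewrite !sumE !pmulr_rlt0//; move: ke.
move: (k.+1%:R^-1) (_ / _) => q u qe h1 h2.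
by rewrite ltr_norml; apply/andP; split; lra.
Unshelve. all: by end_near.
Qed.

End iid_frequencies.

Theorem theorem2 (R : realType) (V : finType) (K : nat)
    (syl : V -> R) (smax : R)
    (syl_bounded : forall w : V, 1 <= syl w <= smax)
    (a b c dflt : R) (coefs : readability_coefs a b c)
    (d : measure_display) (Omega : measurableType d)
    (M : topic_model R V K Omega)
    (t : K.-tuple (measurableTypeR R)) (t_simplex : in_simplex (tnth t))
    (e_pos : 0 < boundary_prob (word_law M t))
    (e_lt1 : boundary_prob (word_law M t) < 1) :
  {ae cond M t, forall x : Omega,
    fkgl syl a b c dflt (fun n => tokens M n x) @ \oo
      --> fkgl_limit syl a b c (word_law M t)}.
Proof.
have slln := strong_law (cond M t) (tokens M) (word_law M t)
  (tokens_measurable M) (tokens_iid M t_simplex) (prob_kernel t) ^~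
  (word_law_simplex M t_simplex).
rewrite /fkgl_limit; set p := word_law M t in slln e_pos e_lt1 *.
set e := boundary_prob p in e_pos e_lt1 *.
have None_mean : \sum_u p u * (u == None)%:R = e.
  rewrite (bigD1 None)//= mulr1 big1 ?addr0// => u /negPf ->.
  by rewrite mulr0.
(* The boundary token has no syllables, so only the words remain. *)
have syl_mean : \sum_u p u * syl_tok syl u = mean_syl syl p.
  rewrite (bigD1 None)//= mulr0 add0r (reindex_omap Some id)/=; last by case.
  by apply: eq_bigl => w; rewrite eqxx.
apply: filterS2 (slln (fun u => (u == None)%:R)) (slln (syl_tok syl)) => x.
rewrite None_mean syl_mean; set v := fun n => tokens M n x => S_cvg Y_cvg.
have SE n : \sum_(i < n) (v i == None)%:R = (sentences v n)%:R :> R.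
  by rewrite natr_sum.
have {}S_cvg : (sentences v n)%:R / n%:R @[n --> \oo] --> e.
  by under eq_fun do rewrite -SE.
have {}Y_cvg : syllables syl v n / n%:R @[n --> \oo] -->
    mean_syl syl p := Y_cvg.
have W_cvg : 1 - (sentences v n)%:R / n%:R @[n --> \oo] --> 1 - e.
  by apply: cvgB => //; exact: cvg_cst.
have W_neq0 : 1 - e != 0 by rewrite subr_eq0 gt_eqF.
have e_neq0 : e != 0 by rewrite gt_eqF.
(* The score with numerators and denominators divided by [n]; both limiting denominators, [e] and
   [1 - e], are nonzero. *)
have lim : a * ((1 - (sentences v n)%:R / n%:R) / ((sentences v n)%:R / n%:R)) +
    b * ((syllables syl v n / n%:R) / (1 - (sentences v n)%:R / n%:R)) + c
    @[n --> \oo] -->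
    a * ((1 - e) / e) + b * (mean_syl syl p / (1 - e)) + c.
  apply: cvgD; last exact: cvg_cst.
  by apply: cvgD; apply: cvgMr; apply: cvgM => //; exact: cvgV.
apply: cvg_trans lim; apply: near_eq_cvg; near=> n.
have n_gt0 : 0 < n%:R :> R by rewrite ltr0n; near: n; exact: nbhs_infty_gt.
have : 0 < (sentences v n)%:R / n%:R :> R.
  by near: n; exact: cvgr_gt S_cvg _ e_pos.
rewrite pmulr_lgt0 ?invr_gt0// => S_gt0.
have W_gt0 : 0 < 1 - (sentences v n)%:R / n%:R :> R.
  by near: n; apply: cvgr_gt W_cvg _ _; rewrite subr_gt0.
have S_lt : (sentences v n)%:R < n%:R :> R.
  by move: W_gt0; rewrite subr_gt0 ltr_pdivrMr// mul1r.
have WE : (words v n)%:R = n%:R - (sentences v n)%:R :> R.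
  by rewrite /words natrB// ltnW// -(ltr_nat R).
rewrite /fkgl -!(pnatr_eq0 R) WE !gt_eqF ?subr_gt0//=.
by field; rewrite ?gt_eqF ?subr_gt0.
Unshelve. all: by end_near.
Qed.
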